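(* Let $X_1,X_2,\dots$ be independent real random variables with $E[X_j]=0$, $0<\sigma_j^2:=E[X_j^2]$ and $\xi_j:=E|X_j|^3<\infty$ for all $j\ge1$. Let $m\ge1$ be an integer, $p\in(0,1)$, and let $N\sim\mathrm{Binomial}(m,p)$ be independent of the sequence $(X_j)_{j\ge1}$. For $n\ge1$ put $\hat\sigma_n^2:=\frac1n\sum_{j=1}^n\sigma_j^2$ (with $\hat\sigma_n>0$) and $\hat\xi_n:=\frac1n\sum_{j=1}^n\xi_j$. Assume that the limit $\hat\sigma^2:=\lim_{n\to\infty}\frac1n\sum_{j=1}^n\sigma_j^2$ exists and satisfies $0<\hat\sigma^2<\infty$ (with $\hat\sigma>0$). Put $W:=(mp)^{-1/2}\sum_{j=1}^NX_j$. Then $$d_{\mathcal W}\bigl(\mathcal L(W),N(0,\hat\sigma^2)\bigr)\le\Bigl(\hat\sigma\sqrt{\frac{2(1-p)}{\pi}}+C_{\mathcal W}E\Bigl[\frac{\hat\xi_N}{\hat\sigma_N^2}\Bigr]\Bigr)\frac1{\sqrt{mp}}+\frac{2}{\sqrt{mp}}\sum_{n=1}^m\sqrt n\binom mn p^n(1-p)^{m-n}\min\Bigl(\hat\sigma_n\Bigl|1-\frac{\hat\sigma^2}{\hat\sigma_n^2}\Bigr|,\hat\sigma\Bigl|1-\frac{\hat\sigma_n^2}{\hat\sigma^2}\Bigr|\Bigr),$$ where $\hat\xi_N/\hat\sigma_N^2$ is read as $0$ on the event $\{N=0\}$.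
   Context: $\mathcal L(Y)$ denotes the distribution of a random variable $Y$; an empty sum is $0$. $d_{\mathcal W}(\mu,\nu):=\sup_h|\int h\,d\mu-\int h\,d\nu|$, the supremum over all $1$-Lipschitz $h:\mathbb R\to\mathbb R$, is the Wasserstein distance of probability measures on $\mathbb R$ with finite first moment. $C_{\mathcal W}$ is a finite absolute constant in the Wasserstein version of the Berry-Esseen theorem, i.e. a constant such that for all $n\ge1$ and all independent random variables $Y_1,\dots,Y_n$ with $E[Y_j]=0$, $E[Y_j^2]>0$, $E|Y_j|^3<\infty$, writing $B_n^2=\sum_{j=1}^nE[Y_j^2]$, one has $d_{\mathcal W}\bigl(\mathcal L(B_n^{-1}\sum_{j=1}^nY_j),N(0,1)\bigr)\le C_{\mathcal W}B_n^{-3}\sum_{j=1}^nE|Y_j|^3$. *)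

(* Defs.v *)
From HB Require Import structures.
From mathcomp Require Import all_boot all_order all_algebra finmap.
From mathcomp Require Import all_classical all_reals all_analysis.
From mathcomp Require Import measurable_realfun.

Set Implicit Arguments.
Unset Strict Implicit.
Unset Printing Implicit Defensive.

Import Order.TTheory GRing.Theory Num.Theory.
Import numFieldNormedType.Exports.

Local Open Scope classical_set_scope.
Local Open Scope ring_scope.

(* The value lies in [\bar R]; it is finite when both measures have a finite
   first moment, since every 1-Lipschitz function is then integrable. *)
Definition wasserstein (R : realType) (mu nu : probability R R) : \bar R :=
  ereal_sup [set `|\int[mu]_x (h x)%:E - \int[nu]_x (h x)%:E|%E
            | h in [set h : R -> R | 1.-lipschitz h]].

(* [normal_prob] is a measure on [measurableTypeR R], whose measurable sets are
   those of [R] but which carries another display than the one used for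
   real-valued random variables; [normal_law] is its image under the identity.
   The second parameter is the standard deviation, not the variance. *)
Definition idTR (R : realType) : measurableTypeR R -> R := idfun.

HB.instance Definition _ (R : realType) :=
  @isMeasurableFun.Build _ _ (measurableTypeR R) R (@idTR R)
    (@measurable_id _ _ setT).

Definition normal_law (R : realType) (m s : R) : probability R R :=
  distribution (normal_prob m s) (@idTR R : {mfun (measurableTypeR R) >-> R}).

Lemma normal_lawE (R : realType) (m s : R) :
  normal_law m s = normal_prob m s :> (set R -> \bar R).
Proof. by []. Qed.

Definition mutually_independent (d : measure_display) (T : measurableType d)
    (R : realType) (P : probability T R) (I : choiceType)
    (X : I -> {RV P >-> R}) : Prop :=
  forall (J : {fset I}) (B : I -> set R),
    (forall i, measurable (B i)) ->
    P (\bigcap_(i in [set` J]) X i @^-1` B i) =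
      (\prod_(i <- J) P (X i @^-1` B i))%E.

Definition sigma_of_sequence (d : measure_display) (T : measurableType d)
    (R : realType) (P : probability T R) (X : nat -> {RV P >-> R}) :
    set (set T) :=
  <<s \bigcup_j preimage_set_system setT (X j) measurable >>.

Definition independent_of_sequence (d : measure_display) (T : measurableType d)
    (R : realType) (P : probability T R) (N : {RV P >-> nat})
    (X : nat -> {RV P >-> R}) : Prop :=
  forall (A : set nat) (F : set T), sigma_of_sequence X F ->
    P (N @^-1` A `&` F) = (P (N @^-1` A) * P F)%E.

Definition moment2 (d : measure_display) (T : measurableType d) (R : realType)
    (P : probability T R) (Y : {RV P >-> R}) : \bar R :=
  'E_P[fun t => (Y t ^+ 2)%R]%E.

Definition absmoment3 (d : measure_display) (T : measurableType d)
    (R : realType) (P : probability T R) (Y : {RV P >-> R}) : \bar R :=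
  'E_P[fun t => (`|Y t| ^+ 3)%R]%E.

(* Sequences are indexed from 0: [X j] is the (j+1)-st variable of
   the mathematical sequence, so [j < n] ranges over the first n of them. *)
Section sums_of_random_variables.
Context (d : measure_display) (T : measurableType d) (R : realType).
Context (P : probability T R) (a : R).

Definition scaled_sum (n : nat) (Y : 'I_n -> {RV P >-> R}) (t : T) : R :=
  a * \sum_(j < n) Y j t.

Definition scaled_random_sum (N : {RV P >-> nat}) (X : nat -> {RV P >-> R})
    (t : T) : R :=
  a * \sum_(j < N t) X j t.

Lemma measurable_scaled_sum (n : nat) (Y : 'I_n -> {RV P >-> R}) :
  measurable_fun setT (scaled_sum Y).
Proof.
apply: measurable_funM; first exact: measurable_cst.
by apply: measurable_sum => j; exact: measurable_funPT.
Qed.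

HB.instance Definition _ (n : nat) (Y : 'I_n -> {RV P >-> R}) :=
  isMeasurableFun.Build _ _ _ _ (scaled_sum Y) (measurable_scaled_sum Y).

Lemma measurable_scaled_random_sum (N : {RV P >-> nat})
    (X : nat -> {RV P >-> R}) : measurable_fun setT (scaled_random_sum N X).
Proof.
move=> _ B mB; rewrite setTI.
have -> : scaled_random_sum N X @^-1` B =
    \bigcup_n (N @^-1` [set n] `&`
               scaled_sum (fun j : 'I_n => X j) @^-1` B).
  apply/seteqP; split=> [t Bt|t [n _ [/= <-]]//]; by exists (N t).
apply: bigcupT_measurable => n; apply: measurableI.
  by rewrite -[X in measurable X]setTI; exact: (measurable_funPT N).
rewrite -[X in measurable X]setTI.
exact: (measurable_scaled_sum (fun j : 'I_n => X j)).
Qed.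

HB.instance Definition _ (N : {RV P >-> nat}) (X : nat -> {RV P >-> R}) :=
  isMeasurableFun.Build _ _ _ _ (scaled_random_sum N X)
    (measurable_scaled_random_sum N X).

End sums_of_random_variables.

Definition berry_esseen_wasserstein_constant (R : realType) (C : R) : Prop :=
  forall (d : measure_display) (T : measurableType d) (P : probability T R)
    (n : nat) (Y : 'I_n -> {RV P >-> R}),
    (1 <= n)%N ->
    mutually_independent Y ->
    (forall j, 'E_P[Y j]%E = 0%E) ->
    (forall j, (0 < moment2 (Y j))%E) ->
    (forall j, (absmoment3 (Y j) < +oo)%E) ->
    let B := Num.sqrt (\sum_(j < n) fine (moment2 (Y j))) in
    (wasserstein (distribution P (scaled_sum B^-1 Y)) (normal_law 0 1)
     <= (C * B ^- 3 * \sum_(j < n) fine (absmoment3 (Y j)))%:E)%E.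

Definition mean_variance (d : measure_display) (T : measurableType d)
    (R : realType) (P : probability T R) (X : nat -> {RV P >-> R})
    (n : nat) : R :=
  n%:R^-1 * \sum_(j < n) fine (moment2 (X j)).

Definition mean_absmoment3 (d : measure_display) (T : measurableType d)
    (R : realType) (P : probability T R) (X : nat -> {RV P >-> R})
    (n : nat) : R :=
  n%:R^-1 * \sum_(j < n) fine (absmoment3 (X j)).

(* Main.v *)
Require Import Defs.
From HB Require Import structures.
From mathcomp Require Import all_boot all_order all_algebra finmap.
From mathcomp Require Import all_classical all_reals all_analysis.
From mathcomp Require Import measurable_realfun ring lra.

Import Order.TTheory GRing.Theory Num.Theory.
Import numFieldNormedType.Exports.

Local Open Scope classical_set_scope.
Local Open Scope ring_scope.

(** Write [a = (mp)^(-1/2)], [S_n] for the sum of the first [n] variables,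
    [shat_n] for the square root of their mean variance and [Z] for a standard
    normal variable. Since [N] is independent of the sequence, the law of [W]
    is the mixture of the laws of [a S_n] with the binomial weights
    [P(N = n)] ([distribution_random_sum]), and [integral_mixture] turns the
    difference of the two integrals of a 1-Lipschitz [h] into the weighted
    average of [E h(a S_n) - E h(s Z)].

    Put [G c = E h(c Z)]. For each [n] two intermediate normal laws are
    inserted between [a S_n] and [s Z]:
    - from [a S_n] to the normal law with the same variance, of standard
      deviation [a sqrt(n) shat_n]. The Berry-Esseen hypothesis, applied to
      [h] rescaled by that standard deviation, bounds this step by
      [a C xihat_n / shat_n^2] ([berry_esseen_lipschitz]);
    - from there to standard deviation [a sqrt(n) s], and
    - from there to [s]. In these two steps only the scale changes, and
      [|G c - G c'| <= |c - c'| E|Z|], where [E|Z| = sqrt(2/pi)]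
      ([normal_scale_diff]).

    Averaged over [n], the first step gives the expectation of
    [xihat_N / shat_N^2]. The second gives the sum of the minima, because
    [|shat_n - s|] is at most either entry of the minimum
    ([normr_subr_le_relative]) and [E|Z| <= 1]. The third is
    [s E|Z| E|sqrt(N/(mp)) - 1|], and
    [E|sqrt(N/(mp)) - 1| <= E|N/(mp) - 1| <= sqrt((1-p)/(mp))] by the variance
    of the binomial law ([binomial_sqrt_deviation]). *)

Set Implicit Arguments.
Unset Strict Implicit.
Unset Printing Implicit Defensive.

(** * Lipschitz functions *)

Lemma lipschitzP (R : realType) (k : R) (h : R -> R) :
  k.-lipschitz h <-> forall x y, `|h x - h y| <= k * `|x - y|.
Proof.
split => [hl x y|hl [x y] _]; last exact: hl.
exact: (hl (x, y)).
Qed.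

Lemma lipschitz_continuous (R : realType) (k : R) (h : R -> R) :
  k.-lipschitz h -> continuous h.
Proof.
move=> /lipschitzP hl x; apply/cvgrPdist_le => e e0.
near=> y; apply: le_trans (hl x y) _.
have k1 : 0 < `|k| + 1 by rewrite ltr_wpDl.
have : `|x - y| <= e / (`|k| + 1).
  by near: y; apply: cvgr_dist_le => //; rewrite divr_gt0.
rewrite ler_pdivlMr// => /(le_trans _); apply.
rewrite mulrC ler_wpM2l// (le_trans (ler_norm k))// lerDl//.
Unshelve. all: by end_near. Qed.

Lemma lipschitz_bound (R : realType) (k : R) (h : R -> R) (x : R) :
  k.-lipschitz h -> `|h x| <= `|h 0| + k * `|x|.
Proof.
move=> /lipschitzP /(_ x 0); rewrite subr0 => hl.
rewrite -[h x](subrK (h 0)) (le_trans (ler_normD _ _))// addrC lerD2l//.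
Qed.

Lemma lipschitz_scale (R : realType) (h : R -> R) (c : R) :
  1.-lipschitz h -> `|c|.-lipschitz (fun x => h (c * x)).
Proof.
move=> /lipschitzP hl; apply/lipschitzP => x y.
by rewrite (le_trans (hl _ _))// mul1r -mulrBr normrM.
Qed.

Lemma Rintegral_EFin d (T : measurableType d) (R : realType)
    (mu : {measure set T -> \bar R}) (f : T -> R) :
  mu.-integrable setT (EFin \o f) ->
  (\int[mu]_x (f x)%:E = (\int[mu]_x f x)%R%:E)%E.
Proof. by move=> fi; rewrite fineK//; exact: integrable_fin_num. Qed.

Lemma Rintegral_probability_cst d (T : measurableType d) (R : realType)
    (P : probability T R) (r : R) : \int[P]_t r = r.
Proof.
rewrite Rintegral_cst//; transitivity (r * fine (1 : \bar R)); last first.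
  by rewrite mulr1.
congr (r * fine _); exact: probability_setT.
Qed.

(** A Lipschitz function grows at most linearly, so a finite first moment
    suffices. *)
Lemma lipschitz_integrable (R : realType) (nu : probability R R) (k : R)
    (h : R -> R) :
  nu.-integrable setT (fun x => (`|x|)%:E) -> k.-lipschitz h ->
  nu.-integrable setT (EFin \o h).
Proof.
move=> ni hl.
have mh := continuous_measurable_fun (lipschitz_continuous hl).
have k0 : 0 <= k.
  have /lipschitzP/(_ 1 0) := hl.
  by rewrite subr0 normr1 mulr1; exact: le_trans.
apply: (@le_integrable _ _ _ nu _ measurableT _
  (fun x => (`|h 0| + k * `|x|)%:E)).
- exact/measurable_EFinP.
- move=> x _ /=; rewrite lee_fin.
  by rewrite (le_trans (lipschitz_bound x hl))// ler_norm.
- under eq_fun do rewrite EFinD EFinM.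
  apply: integrableD => //; last exact: integrableZl.
  exact: (@finite_measure_integrable_cst _ _ _ nu).
Qed.

(** * Centred normal laws and their scale *)

Section normal_law.
Context {R : realType}.
Local Notation mu := (@lebesgue_measure R).

(** The Radon-Nikodym derivative of a normal measure is only determined almost
    everywhere; it agrees with the density because both have the same integral
    over every measurable set. *)
Lemma ge0_integral_normal_law (s : R) (f : R -> R) :
  measurable_fun setT f -> (forall x, 0 <= f x) ->
  (\int[normal_law 0 s]_x (f x)%:E =
   \int[mu]_x (f x * normal_pdf 0 s x)%:E)%E.
Proof.
move=> mf f0.
rewrite ge0_integral_distribution//=; last exact/measurable_EFinP.
have dom := normal_prob_dominates (0 : R) s.
have mf' : measurable_fun [set: measurableTypeR R] (EFin \o f).
  exact/measurable_EFinP.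
have mRN := measurable_int _ (Radon_Nikodym_SigmaFinite.f_integrable dom).
have mpdf : measurable_fun [set: measurableTypeR R]
   (fun x => (normal_pdf 0 s x)%:E).
  apply/measurable_EFinP; exact: measurable_normal_pdf.
under [RHS]eq_integral do rewrite EFinM.
transitivity (\int[normal_prob 0 s]_x (f x)%:E)%E; first by [].
rewrite -(Radon_Nikodym_SigmaFinite.change_of_variables dom)//=.
apply: ae_eq_integral => //.
- exact: emeasurable_funM.
- exact: emeasurable_funM.
- have RNpdf : ae_eq mu setT
      (Radon_Nikodym_SigmaFinite.f (normal_prob 0 s) mu)
      (fun x => (normal_pdf 0 s x)%:E).
    apply: integral_ae_eq => //.
      exact: Radon_Nikodym_SigmaFinite.f_integrable.
    by move=> E _ mE; rewrite -Radon_Nikodym_SigmaFinite.f_integral.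
  exact: (ae_eqe_mul2l (EFin \o f : measurableTypeR R -> \bar R) RNpdf).
Qed.

Lemma normal_pdf_scale (s x : R) : 0 < s ->
  normal_pdf 0 s (s * x) * s = normal_pdf 0 1 x.
Proof.
move=> s0; rewrite !normal_pdfE ?gt_eqF// /normal_peak /normal_fun !subr0 expr1n mul1r.
have -> : - (s * x) ^+ 2 / (s ^+ 2 *+ 2) = - x ^+ 2 / 2.
  by field; rewrite gt_eqF.
rewrite -mulrnAr sqrtrM ?sqr_ge0// sqrtr_sqr gtr0_norm// invfM mulrAC.
by rewrite [_ * s]mulrC mulVKf ?gt_eqF.
Qed.

Lemma ge0_integral_normal_law_scale (s : R) (g : R -> R) : 0 < s ->
  continuous g -> (forall x, 0 <= g x) ->
  (\int[normal_law 0 s]_x (g x)%:E = \int[normal_law 0 1]_x (g (s * x))%:E)%E.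
Proof.
move=> s0 cg g0.
have mg := continuous_measurable_fun cg.
have cs : continuous (fun x : R => s * x) by exact: mulrl_continuous.
have cgs : continuous (fun x => g (s * x)).
  by move=> x; apply: continuous_comp; [exact: cs|exact: cg].
have mgs := continuous_measurable_fun cgs.
have gs0 x : 0 <= g (s * x) by exact: g0.
apply: etrans (ge0_integral_normal_law s mg g0) _.
apply: etrans (esym (ge0_integral_normal_law 1 mgs gs0)).
have ds (x : R) : is_derive x 1 (fun x : R => s * x) s.
  by apply: is_derive_eq; rewrite ?scaler0 ?addr0 /GRing.scale /= mulr1.
have dsE : (fun x : R => s * x)^`()%classic = cst s.
  by apply/funext => x; rewrite derive1E derive_val.
rewrite (@increasing_ge0_integration_by_substitutionT _ (fun x => s * x)).
- apply: eq_integral => x _ /=; rewrite dsE /= -(@normal_pdf_scale s x s0).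
  by rewrite !fctE/= mulrA.
- by move=> x y xy; rewrite ltr_pM2l.
- by rewrite dsE => x; exact: cst_continuous.
- by rewrite dsE; exact: is_cvg_cst.
- by rewrite dsE; exact: is_cvg_cst.
- by [].
- by apply/gt0_cvgMrNy => //; exact: cvg_id.
- by apply/gt0_cvgMry => //; exact: cvg_id.
- by move=> x; apply: cvgM; [exact: cg|apply: continuous_normal_pdf; rewrite gt_eqF].
- by move=> x; rewrite mulr_ge0// normal_pdf_ge0.
Qed.

(** Substitution of variables is applied to nonnegative continuous integrands,
    hence separately to the two parts of a function; writing them with real
    maxima keeps their continuity visible. *)
Lemma integral_maxE (nu : probability R R) (f : R -> R) :
  (\int[nu]_x (f x)%:E =
   \int[nu]_x (Num.max (f x) 0)%:E - \int[nu]_x (Num.max (- f x) 0)%:E)%E.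
Proof.
rewrite integralE; congr (_ - _)%E.
- by apply: eq_integral => x _; rewrite /= funeposE -EFin_max.
- by apply: eq_integral => x _; rewrite /= funenegE -EFin_max.
Qed.

(** A normal variable of standard deviation [s] has the law of [s Z]. This puts
    all centred normal laws on one probability space, where they can be
    compared pointwise. *)
Lemma integral_normal_law_scale (s : R) (h : R -> R) : 0 < s ->
  continuous h ->
  (\int[normal_law 0 s]_x (h x)%:E = \int[normal_law 0 1]_x (h (s * x))%:E)%E.
Proof.
move=> s0 ch.
have pos_cts (f : R -> R) : continuous f -> continuous (fun x => Num.max (f x) 0).
  by move=> cf x; apply: continuous_max => //; [exact: cf|exact: cvg_cst].
have pos_ge0 (y : R) : 0 <= Num.max y 0 by rewrite le_max lexx orbT.
have cNh : continuous (fun x => - h x) by move=> x; apply: cvgN; exact: ch.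
apply: etrans (integral_maxE (normal_law 0 s) h) _.
apply: etrans (esym (integral_maxE (normal_law 0 1) (fun x => h (s * x)))).
have Epos := ge0_integral_normal_law_scale s0 (pos_cts _ ch) (fun=> pos_ge0 _).
have Eneg := ge0_integral_normal_law_scale s0 (pos_cts _ cNh) (fun=> pos_ge0 _).
exact: (f_equal2 (fun u v : \bar R => u - v)%E Epos Eneg).
Qed.

(** By symmetry the integral is twice the one over the half-line, where
    [x] times the density has the opposite of the density as primitive. *)
Lemma normal_law_absmoment1 :
  (\int[normal_law 0 1]_x (`|x|)%:E = (Num.sqrt (2 / pi) : R)%:E)%E.
Proof.
rewrite ge0_integral_normal_law//.
have cpdf : continuous (normal_pdf (0 : R) 1).
  by apply: continuous_normal_pdf; rewrite oner_eq0.
have pdfE x : normal_pdf 0 1 x = normal_peak 1 * expR (- (x ^+ 2 / 2)) :> R.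
  by rewrite normal_pdfE ?oner_eq0// /normal_fun subr0 expr1n mulNr.
rewrite (@ge0_symfun_integralT _ (fun x => `|x| * normal_pdf 0 1 x)); first last.
- by move=> x /=; rewrite !pdfE normrN sqrrN.
- by move=> x; apply: cvgM; [exact: norm_continuous|exact: cpdf].
- by move=> x; rewrite mulr_ge0// normal_pdf_ge0.
pose F x : R := - (normal_peak 1 * expR (- (x ^+ 2 / 2))).
have dF (x : R) : is_derive x 1 F (x * normal_pdf 0 1 x).
  by apply: is_derive_eq; rewrite !scaler0 add0r pdfE /GRing.scale/=; field.
have Fy : F x @[x --> +oo] --> (0 : R).
  have -> : F = (fun x => - (normal_peak 1 * gauss_fun (x * (Num.sqrt 2)^-1))).
    apply/funext => x; congr (- (_ * expR (- _))).
    by rewrite exprMn exprVn sqr_sqrtr.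
  rewrite -oppr0 -(mulr0 (normal_peak 1)).
  apply: cvgN; apply: cvgM; first exact: cvg_cst.
  apply: cvg_comp; last exact: cvg_gauss_fun.
  by apply/gt0_cvgMly; [rewrite invr_gt0 sqrtr_gt0|exact: cvg_id].
have cxpdf : continuous (fun x : R => x * normal_pdf 0 1 x).
  by move=> x; apply: cvgM; [exact: cvg_id|exact: cpdf].
rewrite -set_itvcy (_ : \int[_]_(_ in _) _ = (normal_peak 1)%:E)%E.
  rewrite -EFinM; congr EFin; rewrite /normal_peak expr1n mul1r.
  have p0 : (0 : R) < pi by exact: pi_gt0.
  rewrite -[pi *+ 2]mulr_natl sqrtrM// invfM mulrA (_ : 2 / Num.sqrt 2 = Num.sqrt 2).
    by rewrite sqrtrM// sqrtrV// ltW.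
  by rewrite -{1}(@sqr_sqrtr _ 2)// expr2 mulfK// gt_eqF// sqrtr_gt0.
transitivity (\int[mu]_(x in `[0%R, +oo[) (x * normal_pdf 0 1 x)%:E)%E.
  apply: eq_integral => x; rewrite inE/= in_itv/= andbT => x0.
  by rewrite ger0_norm.
rewrite (@ge0_continuous_FTC2y _ _ F _ 0)//.
- by rewrite /F expr0n mul0r oppr0 expR0 mulr1 -EFinN opprK add0e.
- by move=> x x0; rewrite mulr_ge0// normal_pdf_ge0.
- exact: continuous_subspaceT.
- apply: cvg_at_right_filter.
  by apply: differentiable_continuous; apply/derivable1_diffP.
- by move=> x _; rewrite derive1E derive_val.
Qed.


Lemma integrable_normal_law_norm :
  (normal_law 0 1 : probability R R).-integrable setT (fun x => (`|x|)%:E).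
Proof.
apply/integrableP; split; first by apply/measurable_EFinP.
under eq_integral do rewrite abse_EFin normr_id.
by rewrite normal_law_absmoment1 ltry.
Qed.

(** Couple the two normal laws through the same [Z]: the integrands differ by at
    most [|c - c'| |Z|]. The bound remains valid at [c = 0], where the law
    degenerates to a point mass, and this is how the event [N = 0] is treated. *)
Lemma normal_scale_diff (h : R -> R) (c c' : R) : 1.-lipschitz h ->
  `|\int[normal_law 0 1]_x h (c * x) - \int[normal_law 0 1]_x h (c' * x)|
    <= `|c - c'| * Num.sqrt (2 / pi).
Proof.
move=> hl; have /lipschitzP hl' := hl.
have hi b : (normal_law 0 1 : probability R R).-integrable setT
    (EFin \o (fun x => h (b * x))).
  exact: lipschitz_integrable integrable_normal_law_norm (lipschitz_scale b hl).
have ni := integrable_normal_law_norm.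
rewrite -RintegralB// (le_trans (le_normr_Rintegral _ _))//.
  by apply: (integrableB _ (hi c) (hi c')).
apply: (@le_trans _ _ (\int[normal_law 0 1]_x (`|c - c'| * `|x|))).
  apply: le_Rintegral => //.
  - apply/integrable_norm; exact: (integrableB _ (hi c) (hi c')).
  - exact: (integrableZl measurableT `|c - c'| ni).
  - by move=> x _; rewrite (le_trans (hl' _ _))// mul1r -mulrBl normrM.
by rewrite RintegralZl// /Rintegral normal_law_absmoment1.
Qed.

End normal_law.

(** * The binomial law *)

Section binomial.
Context {R : realType}.
Implicit Types (m : nat) (p : R).

Lemma binomial_pmf_gt m p k : (m < k)%N -> binomial_pmf m p k = 0.
Proof. by move=> mk; rewrite /binomial_pmf bin_small. Qed.

Lemma binomial_pmfS m p k :
  binomial_pmf m.+1 p k.+1 =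
  (1 - p) * binomial_pmf m p k.+1 + p * binomial_pmf m p k.
Proof.
rewrite /binomial_pmf subSS binS -(mulr_natr _ (_ + _)).
rewrite -(mulr_natr _ 'C(m, k.+1)) -(mulr_natr _ 'C(m, k)) natrD.
have [km|mk] := ltnP k m; first by rewrite -(subnSK km) /unstable.onem !exprS; ring.
by rewrite (@bin_small m k.+1)// !exprS; ring.
Qed.

(** Pascal's rule read as conditioning on one trial: the expectation of [f]
    of a count of [m+1] trials, given the other [m]. It yields the moments by
    induction on the number of trials. *)
Lemma sum_binomial_pmfS m p (f : nat -> R) :
  \sum_(k < m.+2) binomial_pmf m.+1 p k * f k =
  \sum_(k < m.+1) binomial_pmf m p k * ((1 - p) * f k + p * f k.+1).
Proof.
under [RHS]eq_bigr do rewrite mulrDr.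
rewrite [RHS]big_split/= big_ord_recl/=.
under eq_bigr do rewrite binomial_pmfS mulrDl.
rewrite big_split/= addrA; congr (_ + _); last first.
  by apply: eq_bigr => i _; ring.
transitivity (\sum_(k < m.+2) binomial_pmf m p k * ((1 - p) * f k)).
  rewrite [RHS]big_ord_recl/=; congr (_ + _).
    by rewrite /binomial_pmf !expr0 !bin0 !subn0 exprS /unstable.onem; ring.
  by apply: eq_bigr => i _; rewrite /bump/=; ring.
by rewrite big_ord_recr/= binomial_pmf_gt// mul0r addr0.
Qed.

Lemma sum_binomial_pmf m p : \sum_(k < m.+1) binomial_pmf m p k = 1.
Proof.
elim: m => [|m ih].
  by rewrite big_ord1 /binomial_pmf bin0 subn0 !expr0 mulr1.
under eq_bigr => k _ do rewrite -[binomial_pmf _ _ _]mulr1.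
rewrite (sum_binomial_pmfS m p (fun=> 1)) -[RHS]ih; apply: eq_bigr => i _.
by rewrite !mulr1 /unstable.onem subrK mulr1.
Qed.

(** The centre [c] is arbitrary because conditioning on one trial shifts it
    to [c - 1]; at [c = m p] this is the variance. *)
Lemma binomial_second_moment m p c :
  \sum_(k < m.+1) binomial_pmf m p k * (k%:R - c) ^+ 2 =
  m%:R * p * (1 - p) + (m%:R * p - c) ^+ 2.
Proof.
elim: m c => [|m ih] c.
  by rewrite big_ord1 /binomial_pmf bin0 /=; ring.
rewrite (sum_binomial_pmfS m p (fun k => (k%:R - c) ^+ 2)).
under eq_bigr => k _ do rewrite mulrDr (mulrCA _ (1 - p)) (mulrCA _ p).
rewrite big_split/= -!mulr_sumr ih.
have shift (k : nat) : k.+1%:R - c = k%:R - (c - 1) by rewrite -natr1; ring.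
under eq_bigr => k _ do rewrite shift.
by rewrite ih -natr1 /unstable.onem; ring.
Qed.

(** [y^2 - 1 = (y - 1)(y + 1)] and the second factor is at least 1. *)
Lemma normr_subr1_le_sqr (y : R) : 0 <= y -> `|y - 1| <= `|y ^+ 2 - 1|.
Proof.
move=> y0; have -> : y ^+ 2 - 1 = (y - 1) * (y + 1) by ring.
by rewrite normrM ler_peMr// ger0_norm ?addr_ge0// lerDr.
Qed.

(** By [normr_subr1_le_sqr], [E|sqrt(N/(mp)) - 1|] is at most [E|N/(mp) - 1|],
    hence at most the standard deviation [t] of [N/(mp)]. In place of the
    Cauchy-Schwarz inequality, [|u| <= (u^2/t + t)/2] is averaged: the
    right-hand side has expectation [(t^2/t + t)/2 = t]. *)
Lemma binomial_sqrt_deviation m p : (0 < m)%N -> 0 < p < 1 ->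
  \sum_(k < m.+1) binomial_pmf m p k *
    `|(Num.sqrt (m%:R * p))^-1 * Num.sqrt k%:R - 1|
  <= Num.sqrt (1 - p) * (Num.sqrt (m%:R * p))^-1.
Proof.
move=> m0 /andP[p0 p1].
have mp0 : 0 < m%:R * p by rewrite mulr_gt0// ltr0n.
have q0 : 0 < 1 - p by rewrite subr_gt0.
set a := (Num.sqrt _)^-1.
have a0 : 0 < a by rewrite invr_gt0 sqrtr_gt0.
have a2 : a ^+ 2 = (m%:R * p)^-1 by rewrite exprVn sqr_sqrtr// ltW.
set t := Num.sqrt (1 - p) * a.
have t0 : 0 < t by rewrite mulr_gt0// sqrtr_gt0.
have t2 : t ^+ 2 = (1 - p) / (m%:R * p) by rewrite exprMn a2 sqr_sqrtr// ltW.
have pmf0 k : 0 <= binomial_pmf m p k.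
  by apply: binomial_pmf_ge0; rewrite !ltW.
apply: (@le_trans _ _ (\sum_(k < m.+1) binomial_pmf m p k *
    (((k%:R - m%:R * p) ^+ 2 * ((m%:R * p)^-1 ^+ 2 * (t^-1 / 2))) + t / 2))).
  apply: ler_sum => k _; rewrite ler_wpM2l//.
  apply: le_trans (normr_subr1_le_sqr _) _.
    exact: mulr_ge0 (ltW a0) (sqrtr_ge0 _).
  rewrite exprMn a2 sqr_sqrtr ?ler0n//.
  set u := _ - 1.
  have -> : (k%:R - m%:R * p) ^+ 2 * ((m%:R * p)^-1 ^+ 2 * (t^-1 / 2)) =
     `|u| ^+ 2 / t / 2.
    rewrite real_normK ?num_real// /u; field.
    by rewrite !gt_eqF// ltr0n.
  (* the inequality 0 <= (|u| - t)^2, after clearing denominators *)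
  rewrite -mulrDl ler_pdivlMr// -(ler_pM2r t0) mulrDl divfK ?gt_eqF//.
  by rewrite -subr_ge0 (_ : _ - _ = (`|u| - t) ^+ 2) ?sqr_ge0//; ring.
under eq_bigr do rewrite mulrDr mulrA.
rewrite big_split/= -!mulr_suml binomial_second_moment sum_binomial_pmf subrr.
rewrite expr0n addr0 mul1r.
have -> : m%:R * p * (1 - p) * ((m%:R * p)^-1 ^+ 2 * (t^-1 / 2)) = t ^+ 2 * (t^-1 / 2).
  by rewrite t2 /unstable.onem; field; rewrite !gt_eqF// ltr0n.
by rewrite le_eqVlt; apply/orP; left; apply/eqP; field; rewrite gt_eqF.
Qed.
End binomial.

(** * The law of a random sum *)

Section mixture.
Context d (T : measurableType d) (R : realType).

(** Additivity in the measure is first proved for nonnegative functions, then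
    applied to the positive and negative parts of [f]; integrability for
    each component makes all the values finite, so that they can be
    subtracted. *)
Lemma integral_mixture (mu : {measure set T -> \bar R}) (M : nat)
    (w : nat -> R) (nu : nat -> {measure set T -> \bar R}) (f : T -> R) :
  (forall n, 0 <= w n) ->
  (forall A, measurable A -> mu A = \sum_(n < M) (w n)%:E * nu n A)%E ->
  (forall n, (nu n).-integrable setT (EFin \o f)) ->
  mu.-integrable setT (EFin \o f) /\
  \int[mu]_x f x = \sum_(n < M) w n * \int[nu n]_x f x.
Proof.
move=> w0 muE fi.
pose wn n : {nonneg R} := NngNum (w0 n).
pose m_ n := [the {measure set T -> \bar R} of mscale (wn n) (nu n)].
have mf : measurable_fun setT (EFin \o f) := measurable_int _ (fi 0%N).
have ge0E (g : T -> \bar R) : measurable_fun setT g -> (forall x, 0 <= g x)%E ->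
    (\int[mu]_x g x = \sum_(n < M) (w n)%:E * \int[nu n]_x g x)%E.
  move=> mg g0.
  transitivity (\int[msum m_ M]_x g x)%E.
    by apply: eq_measure_integral => A mA _; rewrite muE.
  rewrite ge0_integral_measure_sum//; apply: eq_bigr => n _.
  by rewrite ge0_integral_mscale.
have part (g : T -> \bar R) : measurable_fun setT g -> (forall x, 0 <= g x)%E ->
    (forall n, (nu n).-integrable setT g) ->
    (\int[mu]_x g x =
     (\sum_(n < M) w n * fine (\int[nu n]_x g x))%R%:E)%E.
  move=> mg g0 gi; rewrite ge0E// -sumEFin; apply: eq_bigr => n _.
  by rewrite EFinM fineK// integrable_fin_num.
have mui : mu.-integrable setT (EFin \o f).
  apply/integrableP; split => //.
  rewrite part ?ltry//.
  - exact: measurableT_comp.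
  - by move=> n; exact: integrable_abse.
split=> //.
have pos := part _ (measurable_funepos mf) (funepos_ge0 _)
  (fun n => integrable_funepos measurableT (fi n)).
have neg := part _ (measurable_funeneg mf) (funeneg_ge0 _)
  (fun n => integrable_funeneg measurableT (fi n)).
rewrite /Rintegral integralE pos neg -EFinB/= -sumrB; apply: eq_bigr => n _.
rewrite -mulrBr; congr (_ * _); rewrite [in RHS]integralE; apply/esym/fineB.
- exact: (integrable_fin_num measurableT (integrable_funepos measurableT (fi n))).
- exact: (integrable_fin_num measurableT (integrable_funeneg measurableT (fi n))).
Qed.

End mixture.

Section random_sum.
Context d (T : measurableType d) (R : realType) (P : probability T R).

(** The sum is measurable for the sigma-algebra generated by the sequence
    alone; this is what the independence of [N] and the sequence speaks of. *)
Lemma scaled_sum_sigma (X : nat -> {RV P >-> R}) (a : R) (n : nat) (B : set R) :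
  measurable B ->
  sigma_of_sequence X (scaled_sum a (fun j : 'I_n => X j) @^-1` B).
Proof.
move=> mB.
pose G := \bigcup_j preimage_set_system setT (X j) measurable.
have mX j : measurable_fun (setT : set (g_sigma_algebraType G)) (X j).
  by move=> _ A mA; apply: sub_sigma_algebra; exists j => //; exists A.
have mS : measurable_fun (setT : set (g_sigma_algebraType G))
    (scaled_sum a (fun j : 'I_n => X j)).
  apply: measurable_funM; first exact: measurable_cst.
  by apply: measurable_sum => j; exact: mX.
by have := mS measurableT B mB; rewrite setTI.
Qed.

(** Partition by the value of [N]: on [N = n] the random sum is the sum of
    [n] terms, and independence factors the probability. *)
Lemma distribution_random_sum (X : nat -> {RV P >-> R}) (N : {RV P >-> nat})
    (m : nat) (w : nat -> R) (a : R) (B : set R) :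
  independent_of_sequence N X ->
  (forall n, P (N @^-1` [set n]) = (w n)%:E) ->
  (forall n, (m < n)%N -> w n = 0) ->
  measurable B ->
  (distribution P (scaled_random_sum a N X) B =
   \sum_(n < m.+1) (w n)%:E *
     distribution P (scaled_sum a (fun j : 'I_n => X j)) B)%E.
Proof.
move=> NX Nw wm mB; rewrite /distribution /pushforward.
pose F n := N @^-1` [set n] `&` scaled_sum a (fun j : 'I_n => X j) @^-1` B.
have -> : scaled_random_sum a N X @^-1` B = \bigcup_n F n.
  apply/seteqP; split=> [t Bt|t [n _ [/= <-]]//]; by exists (N t).
have FE n : (P (F n) = (w n)%:E *
    P (scaled_sum a (fun j : 'I_n => X j) @^-1` B))%E.
  by rewrite NX ?Nw//; exact: scaled_sum_sigma.
have mF n : measurable (F n).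
  apply: measurableI; rewrite -[X in measurable X]setTI.
    exact: measurable_funPT.
  exact: measurable_scaled_sum.
rewrite measure_semi_bigcup//; last 2 first.
- by move=> i j _ _ [t [[/= <- _] [/= <- _]]].
- exact: bigcupT_measurable.
rewrite (@nneseries_split _ _ 0 m.+1)//= add0n [X in (_ + X)%E]eseries0.
  by rewrite adde0 big_mkord; apply: eq_bigr => n _; rewrite FE.
by move=> n /wm wn0 _; rewrite FE wn0 mul0e.
Qed.

End random_sum.

Section binomial_count.
Context d (T : measurableType d) (R : realType) (P : probability T R).
Context (m : nat) (p : R) (p01 : 0 < p < 1).
Context (N : {RV P >-> nat}).
Hypothesis N_law : distribution P N = binomial_prob m p :> (set nat -> \bar R).

Let p01' : 0 <= p <= 1.
Proof. by case/andP: p01 => p0 p1; rewrite !ltW. Qed.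

Lemma binomial_count_pmf n : (P (N @^-1` [set n]) = (binomial_pmf m p n)%:E)%E.
Proof.
apply: etrans (congr1 (fun f => f [set n]) N_law) _; rewrite /binomial_prob p01'.
by rewrite esum_set1// lee_fin binomial_pmf_ge0.
Qed.

Lemma expectation_binomial_count (g : nat -> R) : (forall n, 0 <= g n) ->
  ('E_P[fun t => g (N t)] =
   (\sum_(n < m.+1) binomial_pmf m p n * g n)%R%:E)%E.
Proof.
move=> g0; rewrite unlock.
have mg : measurable_fun setT (EFin \o g) by [].
transitivity (\int[distribution P N]_n (g n)%:E)%E.
  by rewrite ge0_integral_distribution// => n; rewrite lee_fin.
transitivity (\int[binomial_prob m p]_n (g n)%:E)%E.
  by apply: eq_measure_integral => A _ _; exact: (congr1 (fun f => f A) N_law).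
have [p0 p1] := andP p01'.
rewrite (integral_binomial _ p1)//.
by rewrite -sumEFin; apply: eq_bigr => n _; rewrite EFinM.
Qed.

End binomial_count.

(** * The Berry-Esseen bound for partial sums *)

(** A family of events indexed by ['I_n] is extended to all of [nat] by the
    full set, which changes neither side of the product rule. *)
Lemma mutually_independent_ord d (T : measurableType d) (R : realType)
    (P : probability T R) (X : nat -> {RV P >-> R}) (n : nat) :
  mutually_independent X -> mutually_independent (fun j : 'I_n => X j).
Proof.
move=> Xi J B mB.
pose B' i := if insub i is Some j then B j else setT.
have B'E (j : 'I_n) : B' j = B j by rewrite /B' valK.
have mB' i : measurable (B' i).
  by rewrite /B'; case: insubP => [j _ _|_]; [exact: mB|exact: measurableT].
have := Xi [fset val j | j in J]%fset B' mB'.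
rewrite big_imfset/=; last by move=> i j _ _; exact: val_inj.
under eq_bigr do rewrite B'E.
move=> <-; congr (P _); apply/seteqP; split=> t /= Jt.
  by move=> _ /= /imfsetP[j jJ ->]; rewrite /preimage/= B'E; exact: Jt.
move=> j jJ; have := Jt (val j); rewrite /preimage/= B'E; apply.
by apply/imfsetP; exists j.
Qed.

(** The transfer formula requires integrability on the sample space; here it is
    deduced from integrability for the law. *)
Lemma Rintegral_distribution d (T : measurableType d) (R : realType)
    (P : probability T R) (Y : {RV P >-> R}) (f : R -> R) :
  (distribution P Y).-integrable setT (EFin \o f) ->
  P.-integrable setT (EFin \o (f \o Y)) /\
  \int[distribution P Y]_x f x = \int[P]_t f (Y t).
Proof.
move=> fi; have mf := measurable_int _ fi.
have Pfi : P.-integrable setT (EFin \o (f \o Y)).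
  apply/integrableP; split.
    exact: (measurableT_comp mf (measurable_funPT Y)).
  have /integrableP[_] := fi; apply: le_lt_trans.
  by rewrite ge0_integral_distribution//; exact: measurableT_comp.
by split=> //; congr fine; exact: integral_distribution.
Qed.

Section moments.
Context d (T : measurableType d) (R : realType) (P : probability T R).
Context (Y : {RV P >-> R}) (Y3 : (absmoment3 Y < +oo)%E).

Let integrable_cube :
  P.-integrable setT (fun t => (1 + `|Y t| ^+ 3)%:E).
Proof.
under eq_fun do rewrite EFinD.
apply: integrableD => //; first exact: (@finite_measure_integrable_cst _ _ _ P).
apply/integrableP; split.
  apply/measurable_EFinP; apply: measurable_funX.
  by apply: measurableT_comp => //; exact: measurable_funPT.
apply: (le_lt_trans _ Y3); rewrite /absmoment3 unlock.
by under eq_integral do rewrite gee0_abs ?lee_fin//.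
Qed.

(** Finiteness of the third absolute moment controls all the lower ones through
    this bound. *)
Let le_cube (u : R) (k : nat) : 0 <= u -> (k <= 3)%N -> u ^+ k <= 1 + u ^+ 3.
Proof.
move=> u0 k3; have [u1|u1] := leP u 1.
  by rewrite (le_trans (exprn_ile1 _ u0 u1))// lerDl exprn_ge0.
by rewrite (le_trans (ler_weXn2l (ltW u1) k3))// lerDr.
Qed.

Lemma absmoment3_integrable (k : nat) : (k <= 3)%N ->
  P.-integrable setT (fun t => (`|Y t| ^+ k)%:E).
Proof.
move=> k3; apply: (le_integrable _ _ _ integrable_cube) => //.
  apply/measurable_EFinP; apply: measurable_funX.
  by apply: measurableT_comp => //; exact: measurable_funPT.
move=> t _; rewrite lee_fin normrX normr_id (le_trans _ (ler_norm _))//.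
exact: le_cube.
Qed.

Lemma moment2_fin_num : moment2 Y \is a fin_num.
Proof.
rewrite /moment2 unlock.
have := absmoment3_integrable (isT : (2 <= 3)%N).
under eq_fun do rewrite real_normK ?num_real//.
by move=> /(integrable_fin_num measurableT).
Qed.

Lemma absmoment3_fine_ge0 : 0 <= fine (absmoment3 Y).
Proof.
by apply: fine_ge0; rewrite /absmoment3 expectation_ge0// => t; rewrite exprn_ge0.
Qed.

End moments.

Section berry_esseen.
Context d (T : measurableType d) (R : realType) (P : probability T R).
Context (X : nat -> {RV P >-> R}).
Hypothesis X_indep : mutually_independent X.
Hypothesis X_mean : forall j, 'E_P[X j]%E = 0%E.
Hypothesis X_var : forall j, (0 < moment2 (X j))%E.
Hypothesis X_third : forall j, (absmoment3 (X j) < +oo)%E.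
Local Notation S a n := (scaled_sum a (fun j : 'I_n => X j)).

Lemma integrable_scaled_sum_norm (a : R) (n : nat) :
  (distribution P (S a n) : probability R R).-integrable setT
    (fun x => (`|x|)%:E).
Proof.
apply: (@integrable_pushforward _ _ _ _ _ (S a n)
  (measurable_scaled_sum a (fun j : 'I_n => X j)) P setT) => //.
  by apply/measurable_EFinP.
rewrite preimage_setT.
apply: (@le_integrable _ _ _ P _ measurableT _
  (fun t => (`|a|)%:E * \sum_(j < n) (`|X j t| ^+ 1)%:E)%E).
- apply: measurableT_comp; first by apply/measurable_EFinP.
  exact: (measurable_scaled_sum a (fun j : 'I_n => X j)).
- move=> t _ /=; rewrite sumEFin -EFinM lee_fin normr_id /scaled_sum !normrM.
  rewrite normr_id ler_wpM2l// (le_trans _ (ler_norm _))//.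
  exact: ler_norm_sum.
- apply: integrableZl => //; apply: integrable_sum => // j _.
  exact: absmoment3_integrable.
Qed.

Lemma mean_variance_gt0 n : (0 < n)%N -> 0 < mean_variance X n.
Proof.
move=> n0; rewrite mulr_gt0 ?invr_gt0 ?ltr0n//.
case: n n0 => // n _; rewrite big_ord_recl ltr_pwDl//.
  by apply: fine_gt0; rewrite X_var ltey_eq moment2_fin_num.
by apply: sumr_ge0 => j _; apply: fine_ge0; exact: ltW.
Qed.

Lemma mean_absmoment3_ge0 n : 0 <= mean_absmoment3 X n.
Proof.
rewrite mulr_ge0 ?invr_ge0//; apply: sumr_ge0 => j _.
exact: absmoment3_fine_ge0.
Qed.

(** The Berry-Esseen hypothesis concerns [S_n / B] where
    [B = sqrt(n) shat_n], against the standard normal law. With [c = a B] one has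
    [a S_n = c (S_n / B)], and [x -> h (c x) / c] is again 1-Lipschitz;
    the error is therefore multiplied by [c]. *)
Lemma berry_esseen_lipschitz (C a : R) (n : nat) (h : R -> R) :
  berry_esseen_wasserstein_constant C -> 0 < a -> (0 < n)%N ->
  1.-lipschitz h ->
  `|\int[distribution P (S a n)]_x h x - \int[normal_law 0 1]_x
      h (a * (Num.sqrt n%:R * Num.sqrt (mean_variance X n)) * x)|
  <= a * (C * (mean_absmoment3 X n / Num.sqrt (mean_variance X n) ^+ 2)).
Proof.
move=> hC a0 n0 hl; set shat := Num.sqrt (mean_variance X n).
have v0 := mean_variance_gt0 n0.
have shat0 : 0 < shat by rewrite sqrtr_gt0.
have n0R : 0 < n%:R :> R by rewrite ltr0n.
pose B := Num.sqrt n%:R * shat.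
have B0 : 0 < B by rewrite mulr_gt0// sqrtr_gt0.
have BE : Num.sqrt (\sum_(j < n) fine (moment2 (X j))) = B.
  by rewrite /B /shat -sqrtrM ?ler0n// /mean_variance mulrA mulfV ?mul1r// gt_eqF//.
pose c := a * B; have c0 : 0 < c by rewrite mulr_gt0.
pose g x := c^-1 * h (c * x).
have gl : 1.-lipschitz g.
  move: hl => /lipschitzP hl; apply/lipschitzP => x y.
  rewrite -mulrBr normrM gtr0_norm ?invr_gt0// ler_pdivrMl//.
  by rewrite (le_trans (hl _ _))// !mul1r -mulrBr normrM gtr0_norm.
have hi : (distribution P (S a n) : probability R R).-integrable setT
    (EFin \o h).
  exact: lipschitz_integrable (integrable_scaled_sum_norm a n) hl.
have gi : (distribution P (S B^-1 n) : probability R R).-integrable setT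
    (EFin \o g).
  exact: lipschitz_integrable (integrable_scaled_sum_norm B^-1 n) gl.
have zi : (normal_law 0 1 : probability R R).-integrable setT
    (EFin \o (fun x => h (c * x))).
  exact: lipschitz_integrable integrable_normal_law_norm (lipschitz_scale c hl).
have gzi : (normal_law 0 1 : probability R R).-integrable setT (EFin \o g).
  exact: lipschitz_integrable integrable_normal_law_norm gl.
have ES : \int[distribution P (S B^-1 n)]_x g x =
    c^-1 * \int[distribution P (S a n)]_x h x.
  have [_ ->] := Rintegral_distribution gi.
  have [Phi ->] := Rintegral_distribution hi.
  rewrite -RintegralZl//; apply: eq_Rintegral => t _; rewrite /g /scaled_sum.
  by rewrite mulrA /c mulfK// gt_eqF.
have EZ : \int[normal_law 0 1]_x g x = c^-1 * \int[normal_law 0 1]_x h (c * x).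
  by rewrite RintegralZl.
have := hC _ _ P n _ n0 (mutually_independent_ord X_indep)
  (fun j => X_mean j) (fun j => X_var j) (fun j => X_third j).
rewrite /= BE => /(le_trans (ereal_sup_ubound _)) => /(_ _ (ex_intro2 _ _ g gl erefl)).
rewrite !Rintegral_EFin// -EFinB abse_EFin lee_fin ES EZ -mulrBr normrM.
rewrite gtr0_norm ?invr_gt0// ler_pdivrMl// => /le_trans; apply.
rewrite le_eqVlt; apply/orP; left; apply/eqP.
have -> : \sum_(j < n) fine (absmoment3 (X j)) = n%:R * mean_absmoment3 X n.
  by rewrite mulrA mulfV ?mul1r// gt_eqF.
have -> : n%:R = Num.sqrt n%:R ^+ 2 :> R by rewrite sqr_sqrtr// ltW.
rewrite /c /B; field.
by rewrite !gt_eqF// sqrtr_gt0.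
Qed.

End berry_esseen.

(** * The bound for the random sum *)

(** The right-hand side is [|u - v| (u + v) / u]. With [u] and [v] exchanged it
    also bounds [|u - v|] by the other entry of the minimum. *)
Lemma normr_subr_le_relative (R : rcfType) (u v : R) : 0 < u -> 0 < v ->
  `|u - v| <= u * `|1 - v ^+ 2 / u ^+ 2|.
Proof.
move=> u0 v0; have -> : 1 - v ^+ 2 / u ^+ 2 = (u - v) * ((u + v) / u ^+ 2).
  by field; rewrite gt_eqF.
have r0 : 0 < (u + v) / u ^+ 2 by rewrite divr_gt0 ?addr_gt0 ?exprn_gt0.
rewrite normrM (gtr0_norm r0).
rewrite mulrCA ler_peMr// (_ : u * _ = 1 + v / u); last first.
  by field; rewrite gt_eqF.
by rewrite lerDl divr_ge0// ltW.
Qed.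

Lemma sqrt_2_div_pi_le1 (R : realType) : Num.sqrt (2 / pi) <= 1 :> R.
Proof.
rewrite -[leRHS]sqrtr1; apply: ler_wsqrtr.
by rewrite ler_pdivrMr ?pi_gt0// mul1r pi_ge2.
Qed.

Unset Implicit Arguments.

Theorem theorem3p11 (R : realType) (C : R)
    (hC : berry_esseen_wasserstein_constant C)
    (d : measure_display) (T : measurableType d) (P : probability T R)
    (X : nat -> {RV P >-> R})
    (X_indep : mutually_independent X)
    (X_mean : forall j, 'E_P[X j]%E = 0%E)
    (X_var : forall j, (0 < moment2 (X j))%E)
    (X_third : forall j, (absmoment3 (X j) < +oo)%E)
    (m : nat) (hm : (1 <= m)%N)
    (p : R) (hp : 0 < p < 1)
    (N : {RV P >-> nat})
    (N_law : distribution P N = binomial_prob m p :> (set nat -> \bar R))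
    (N_indep : independent_of_sequence N X)
    (s : R) (hs : 0 < s)
    (hlim : mean_variance X n @[n --> \oo] --> s ^+ 2) :
  let W : {RV P >-> R} := scaled_random_sum (Num.sqrt (m%:R * p))^-1 N X in
  let shat n := Num.sqrt (mean_variance X n) in
  (wasserstein (distribution P W) (normal_law 0 s)
   <= ((s * Num.sqrt (2 * (1 - p) / pi))%:E
       + C%:E * 'E_P[fun t => (if N t == 0%N then 0
                               else mean_absmoment3 X (N t) / shat (N t) ^+ 2)%R])
      * ((Num.sqrt (m%:R * p))^-1)%:E
      + (2 / Num.sqrt (m%:R * p)
         * \sum_(1 <= n < m.+1)
             Num.sqrt n%:R * 'C(m, n)%:R * p ^+ n * (1 - p) ^+ (m - n)
             * Num.min (shat n * `|1 - s ^+ 2 / shat n ^+ 2|)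
                       (s * `|1 - shat n ^+ 2 / s ^+ 2|))%:E)%E.
Proof.
cbv zeta.
set W : {RV P >-> R} := reverse_coercion _ _.
pose shat n := Num.sqrt (mean_variance X n).
have mp0 : 0 < m%:R * p by case/andP: hp => p0 _; rewrite mulr_gt0// ltr0n.
set a := (Num.sqrt (m%:R * p))^-1.
have a0 : 0 < a by rewrite invr_gt0 sqrtr_gt0.
have w0 n : 0 <= binomial_pmf m p n.
  by apply: binomial_pmf_ge0; case/andP: hp => p0 p1; rewrite !ltW.
set g : nat -> R :=
  fun n => if n == 0%N then 0 else mean_absmoment3 X n / shat n ^+ 2.
have g0 n : 0 <= g n.
  by rewrite /g; case: ifP => // _; rewrite divr_ge0 ?mean_absmoment3_ge0 ?sqr_ge0.
rewrite (expectation_binomial_count hp N_law g0).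
rewrite -EFinM -EFinD.
apply: ge_ereal_sup => _ [h hl <-].
pose L n := distribution P (scaled_sum a (fun j : 'I_n => X j)).
have Li n : (L n : probability R R).-integrable setT (EFin \o h).
  exact: lipschitz_integrable (integrable_scaled_sum_norm X_third a n) hl.
have LW B : measurable B -> (distribution P W B =
    \sum_(n < m.+1) (binomial_pmf m p n)%:E * L n B)%E.
  exact: (distribution_random_sum a N_indep (binomial_count_pmf hp N_law)
    (@binomial_pmf_gt _ m p)).
have [Wi WE] := integral_mixture w0 LW Li.
pose G c := \int[normal_law 0 1]_x h (c * x).
have Gi c : (normal_law 0 1 : probability R R).-integrable setT
    (EFin \o (fun x => h (c * x))).
  exact: lipschitz_integrable integrable_normal_law_norm (lipschitz_scale c hl).
pose k : R := Num.sqrt (2 / pi).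
have k0 : 0 <= k by exact: sqrtr_ge0.
have Gdiff c c' : `|G c - G c'| <= `|c - c'| * k by exact: normal_scale_diff.
have -> : (\int[normal_law 0 s]_x (h x)%:E = (G s)%:E)%E.
  rewrite -(Rintegral_EFin (Gi s)).
  exact: integral_normal_law_scale hs (lipschitz_continuous hl).
rewrite (Rintegral_EFin Wi) -EFinB abse_EFin lee_fin WE.
have -> : G s = \sum_(n < m.+1) binomial_pmf m p n * G s.
  by rewrite -mulr_suml sum_binomial_pmf mul1r.
rewrite -sumrB.
(* the three steps from a S_n to s Z *)
have step n : `|\int[L n]_x h x - G s| <=
    a * (C * g n) + a * (Num.sqrt n%:R * `|shat n - s| * k) +
    `|a * Num.sqrt n%:R - 1| * (s * k).
  have third : `|G (a * Num.sqrt n%:R * s) - G s| <=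
      `|a * Num.sqrt n%:R - 1| * (s * k).
    apply: (le_trans (Gdiff _ _)).
    by rewrite -{2}[s]mul1r -mulrBl normrM (gtr0_norm hs) mulrA.
  have second : `|G (a * (Num.sqrt n%:R * shat n)) - G (a * Num.sqrt n%:R * s)|
      <= a * (Num.sqrt n%:R * `|shat n - s| * k).
    apply: (le_trans (Gdiff _ _)).
    rewrite -mulrA -mulrBr -mulrBr normrM (gtr0_norm a0) normrM.
    by rewrite ger0_norm ?sqrtr_ge0// !mulrA.
  have first : `|\int[L n]_x h x - G (a * (Num.sqrt n%:R * shat n))| <=
      a * (C * g n).
    (* for n = 0 both laws are the point mass at 0 *)
    case: n {second third} => [|n]; last exact: berry_esseen_lipschitz.
    rewrite /g eqxx !mulr0 sqrtr0 mul0r mulr0.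
    have [_ ->] := Rintegral_distribution (Li 0%N).
    have -> : \int[P]_t h (scaled_sum a (fun j : 'I_0 => X j) t) = h 0.
      under eq_Rintegral do rewrite /scaled_sum big_ord0 mulr0.
      exact: Rintegral_probability_cst.
    have -> : G 0 = h 0.
      rewrite /G; under eq_Rintegral do rewrite mul0r.
      exact: Rintegral_probability_cst.
    by rewrite subrr normr0.
  set I := \int[L n]_x h x; pose u := a * (Num.sqrt n%:R * shat n).
  have -> : I - G s = (I - G u) + (G u - G (a * Num.sqrt n%:R * s)) +
      (G (a * Num.sqrt n%:R * s) - G s) by ring.
  apply: le_trans (ler_normD _ _) (lerD _ third).
  exact: le_trans (ler_normD _ _) (lerD first second).
apply: (le_trans (ler_norm_sum _ _ _)).
apply: (@le_trans _ _ (\sum_(n < m.+1) (binomial_pmf m p n *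
   (a * (C * g n) + a * (Num.sqrt n%:R * `|shat n - s| * k) +
    `|a * Num.sqrt n%:R - 1| * (s * k))))).
  apply: ler_sum => n _.
  rewrite -mulrBr normrM ger0_norm// ler_wpM2l//; exact: step.
under eq_bigr do rewrite 2!mulrDr.
rewrite !big_split/=.
have -> : \sum_(n < m.+1) binomial_pmf m p n * (a * (C * g n)) =
    C * (\sum_(n < m.+1) binomial_pmf m p n * g n) * a.
  by rewrite mulr_sumr mulr_suml; apply: eq_bigr => n _; ring.
have scale_mismatch :
    \sum_(n < m.+1) binomial_pmf m p n *
      (a * (Num.sqrt n%:R * `|shat n - s| * k)) <=
    2 * a * \sum_(1 <= n < m.+1)
      Num.sqrt n%:R * 'C(m, n)%:R * p ^+ n * (1 - p) ^+ (m - n)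
      * Num.min (shat n * `|1 - s ^+ 2 / shat n ^+ 2|)
                (s * `|1 - shat n ^+ 2 / s ^+ 2|).
  rewrite big_ord_recl/= sqrtr0 !mul0r !mulr0 add0r big_add1/= big_mkord.
  rewrite mulr_sumr; apply: ler_sum => n _; rewrite /bump leq0n add1n.
  set M := Num.min _ _.
  have shat0 : 0 < shat n.+1 by rewrite sqrtr_gt0 mean_variance_gt0.
  have dM : `|shat n.+1 - s| <= M.
    rewrite le_min normr_subr_le_relative//= distrC.
    exact: normr_subr_le_relative.
  have -> : 2 * a * (Num.sqrt n.+1%:R * 'C(m, n.+1)%:R * p ^+ n.+1 *
      (1 - p) ^+ (m - n.+1) * M) =
      binomial_pmf m p n.+1 * (a * (Num.sqrt n.+1%:R * M * 2)).
    by rewrite /binomial_pmf -(mulr_natr _ 'C(m, n.+1)) /unstable.onem; ring.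
  apply: ler_wpM2l => //; apply: ler_wpM2l; first exact: ltW.
  apply: ler_pM => //; last by rewrite (le_trans (sqrt_2_div_pi_le1 R))// ler1n.
  by apply: ler_wpM2l; first exact: sqrtr_ge0.
have count_deviation :
    \sum_(n < m.+1) binomial_pmf m p n *
      (`|a * Num.sqrt n%:R - 1| * (s * k)) <=
    s * Num.sqrt (2 * (1 - p) / pi) * a.
  have -> : s * Num.sqrt (2 * (1 - p) / pi) * a =
      (Num.sqrt (1 - p) * a) * (s * k).
    case/andP: hp => p0 p1.
    rewrite (_ : 2 * (1 - p) / pi = (1 - p) * (2 / pi)); last by rewrite mulrAC mulrC.
    by rewrite sqrtrM ?subr_ge0 ?ltW// /k; ring.
  under eq_bigr do rewrite mulrA.
  rewrite -mulr_suml; apply: ler_wpM2r; first exact: mulr_ge0 (ltW hs) k0.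
  exact: binomial_sqrt_deviation.
rewrite mulrDl; move: scale_mismatch count_deviation; rewrite -/(shat _).
lra.
Qed.
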